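(* Let $\mathcal{H}$ be a complex Hilbert space, let $A\in\mathcal{B}(\mathcal{H})$ be positive semidefinite, and let $T\in\mathcal{B}_A(\mathcal{H})$. Then $$\begin{aligned} dw_A^2(T)\le \inf_{\lambda\in\mathbb{R}}\sup_{\theta\in\mathbb{R}}\Big\{ & 2|\lambda|\,\big\|\cos\theta\, Re_A(T)+|T|_A^2+\sin\theta\, Im_A(T)-\lambda I\big\|_A\\ &+\tfrac12\big\|\cos\theta\, Re_A(T)+|T|_A^2+\sin\theta\, Im_A(T)-2\lambda I\big\|_A^2\\ &+\tfrac12\big\|\cos\theta\, Re_A(T)-|T|_A^2+\sin\theta\, Im_A(T)\big\|_A^2\Big\}.\end{aligned}$$ In particular, $$dw_A^2(T)\le\frac12\sup_{\theta\in\mathbb{R}}\Big\{\big\|\cos\theta\, Re_A(T)+|T|_A^2+\sin\theta\, Im_A(T)\big\|_A^2+\big\|\cos\theta\, Re_A(T)-|T|_A^2+\sin\theta\, Im_A(T)\big\|_A^2\Big\}.$$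
   Context: $\mathcal{B}(\mathcal{H})$ is the algebra of bounded linear operators on the complex Hilbert space $\mathcal{H}$, with identity $I$. For a positive semidefinite $A\in\mathcal{B}(\mathcal{H})$, put $\langle x,y\rangle_A=\langle Ax,y\rangle$ and $\|x\|_A=\sqrt{\langle x,x\rangle_A}$. $\mathcal{B}_A(\mathcal{H})$ is the set of $T\in\mathcal{B}(\mathcal{H})$ admitting an $A$-adjoint, i.e. such that $AX=T^*A$ has a solution $X\in\mathcal{B}(\mathcal{H})$; then $T^{\sharp_A}$ denotes the unique solution with $\mathcal{R}(T^{\sharp_A})\subseteq\overline{\mathcal{R}(A)}$ ($\mathcal{R}$ denotes range). Every $T\in\mathcal{B}_A(\mathcal{H})$ is $A$-bounded, i.e. $\|Tx\|_A\le c\|x\|_A$ for all $x$ and some $c>0$. Write $|T|_A^2=T^{\sharp_A}T$, $Re_A(T)=\frac12(T+T^{\sharp_A})$, $Im_A(T)=\frac1{2\mathrm{i}}(T-T^{\sharp_A})$. For $A$-bounded $T$: $\|T\|_A=\sup\{\|Tx\|_A:\|x\|_A=1\}$ and $dw_A(T)=\sup\{\sqrt{|\langle Tx,x\rangle_A|^2+\|Tx\|_A^4}:\|x\|_A=1\}$, where $x$ ranges over $\mathcal{H}$. $dw_A^2(T)$ means $(dw_A(T))^2$. *)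

(* Defs.v *)
From HB Require Import structures.
From mathcomp Require Import all_boot all_order all_algebra sesquilinear.
From mathcomp Require Import complex.
From mathcomp Require Import all_classical all_reals all_analysis.

Set Implicit Arguments.
Unset Strict Implicit.
Unset Printing Implicit Defensive.

Import Order.TTheory GRing.Theory Num.Theory.
Import numFieldNormedType.Exports.

Local Open Scope classical_set_scope.
Local Open Scope ring_scope.
Local Open Scope complex_scope.

(* A complex Hilbert space is a complete normed module [H] over [R[i]] together
   with a positive definite Hermitian form [dot] (linear in its first argument)
   that induces the norm of [H]. *)
Definition induces_norm (R : realType) (H : completeNormedModType R[i])
    (dot : {dot H for (@Num.conj R[i])}) : Prop :=
  forall x : H, `|x| ^+ 2 = dot x x.

Definition bounded_operators (R : realType) (H : completeNormedModType R[i]) :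
    set (H -> H) :=
  [set T | linear T /\ exists c : R, forall x, `|T x| <= c%:C * `|x|].

(* The order of [R[i]] makes [0 <= z] mean that [z] is real and nonnegative. *)
Definition psd_operator (R : realType) (H : completeNormedModType R[i])
    (dot : {dot H for (@Num.conj R[i])}) (A : H -> H) : Prop :=
  bounded_operators A /\ forall x, 0 <= dot (A x) x.

(* [T^*]; the operator selected is the only element of the set, and the default
   value [0] is used when the set is empty, i.e. never for bounded [T]. *)
Definition adjoint (R : realType) (H : completeNormedModType R[i])
    (dot : {dot H for (@Num.conj R[i])}) (T : H -> H) : H -> H :=
  xget 0 [set S | bounded_operators S /\
                  forall x y, dot (T x) y = dot x (S y)].

Definition A_adjoints (R : realType) (H : completeNormedModType R[i])
    (dot : {dot H for (@Num.conj R[i])}) (A T : H -> H) : set (H -> H) :=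
  [set X | bounded_operators X /\ A \o X = adjoint dot T \o A].

Definition A_adjointable (R : realType) (H : completeNormedModType R[i])
    (dot : {dot H for (@Num.conj R[i])}) (A : H -> H) : set (H -> H) :=
  [set T | bounded_operators T /\ A_adjoints dot A T !=set0].

(* The A-adjoint with range in the closure of the range of [A], which is unique
   and exists for [T] in [A_adjointable dot A]. *)
Definition sharp (R : realType) (H : completeNormedModType R[i])
    (dot : {dot H for (@Num.conj R[i])}) (A T : H -> H) : H -> H :=
  xget 0 [set X | A_adjoints dot A T X /\ range X `<=` closure (range A)].

Definition A_dot (R : realType) (H : completeNormedModType R[i])
    (dot : {dot H for (@Num.conj R[i])}) (A : H -> H) (x y : H) : R[i] :=
  dot (A x) y.

Definition A_norm (R : realType) (H : completeNormedModType R[i])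
    (dot : {dot H for (@Num.conj R[i])}) (A : H -> H) (x : H) : R :=
  Num.sqrt (complex.Re (A_dot dot A x x)).

(* If [A = 0] the suprema below range over the empty set, and [sup set0 = 0]. *)
Definition A_opnorm (R : realType) (H : completeNormedModType R[i])
    (dot : {dot H for (@Num.conj R[i])}) (A T : H -> H) : R :=
  sup [set A_norm dot A (T x) | x in [set x | A_norm dot A x = 1]].

(* [complex.Re `|z|] is the modulus of [z] as an element of [R]. *)
Definition dw (R : realType) (H : completeNormedModType R[i])
    (dot : {dot H for (@Num.conj R[i])}) (A T : H -> H) : R :=
  sup [set Num.sqrt (complex.Re `|A_dot dot A (T x) x| ^+ 2
                     + A_norm dot A (T x) ^+ 4)
      | x in [set x | A_norm dot A x = 1]].

Definition A_abs2 (R : realType) (H : completeNormedModType R[i])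
    (dot : {dot H for (@Num.conj R[i])}) (A T : H -> H) : H -> H :=
  sharp dot A T \o T.

Definition A_Re (R : realType) (H : completeNormedModType R[i])
    (dot : {dot H for (@Num.conj R[i])}) (A T : H -> H) : H -> H :=
  (2^-1 : R[i]) *: (T + sharp dot A T).

Definition A_Im (R : realType) (H : completeNormedModType R[i])
    (dot : {dot H for (@Num.conj R[i])}) (A T : H -> H) : H -> H :=
  ((2 * 'i%C)^-1 : R[i]) *: (T - sharp dot A T).

(* Main.v *)
(* For a unit vector x of the A-seminorm put a = <Tx,x>_A, b = ||Tx||_A^2, and
   choose theta with cos theta Re a + sin theta Im a = |a|. The operators
   cos theta Re_A(T) +- |T|_A^2 + sin theta Im_A(T) then take the values |a| +- b
   on x, and with s = |a| + b, d = |a| - b,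
     |a|^2 + b^2 = (s^2 + d^2) / 2,   s^2 = (s - 2 lambda)^2 + 4 lambda (s - lambda),
   so the bound follows from |<Dx,x>_A| <= ||D||_A. The suprema have to be
   finite, i.e. T and its A-adjoint have to be A-bounded, which follows from a
   bound on the A-self-adjoint products of T and its A-adjoint. *)
Require Import Defs.
From HB Require Import structures.
From mathcomp Require Import all_boot all_order all_algebra sesquilinear.
From mathcomp Require Import complex ring lra.
From mathcomp Require Import all_classical all_reals all_analysis.

Import Order.TTheory GRing.Theory Num.Theory.
Import numFieldNormedType.Exports.

Local Open Scope classical_set_scope.
Local Open Scope ring_scope.
Local Open Scope complex_scope.

(** * Real quadratics, the order of [R[i]] and linear maps *)

Lemma quad_ge0_discr (R : realType) (p m k : R) :
  0 <= k -> (forall t : R, 0 <= p + 2 * (t * m) + t ^+ 2 * k) -> m ^+ 2 <= p * k.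
Proof.
rewrite le_eqVlt => /predU1P[<-|k0] h.
  have [->|m0] := eqVneq m 0; first by rewrite mulr0 expr0n.
  (* For [k = 0] the quadratic is affine in [t], and this [t] gives it the value -1. *)
  have := h (- (p + 1) / (2 * m)).
  have -> : - (p + 1) / (2 * m) * m = - (p + 1) / 2 by field.
  by lra.
(* The quadratic attains its minimum at this [t]. *)
have := h (- m / k).
have -> : p + 2 * (- m / k * m) + (- m / k) ^+ 2 * k = (p * k - m ^+ 2) / k.
  by field; rewrite gt_eqF.
by rewrite pmulr_lge0 ?invr_gt0// subr_ge0.
Qed.

(** The topology of [H] measures radii in [R[i]]; this turns them into real numbers. *)
Lemma gt0_complexE (R : realType) (z : R[i]) :
  0 < z -> exists2 r : R, 0 < r & z = r%:C.
Proof.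
case: z => a b; rewrite ltcE/= => /andP[/eqP -> a0].
by exists a.
Qed.

Lemma linear_at0 {K : pzRingType} {U V : lmodType K} {f : U -> V} :
  linear f -> f 0 = 0.
Proof.
move=> /(_ 1 0 0); rewrite !scale1r addr0 => f0.
by apply: (addrI (f 0)); rewrite addr0 -f0.
Qed.

(** * Semi-inner products, covering both [dot] and the possibly degenerate [A_dot dot A] *)

Record semi_inner {R : realType} {V : lmodType R[i]} (s : V -> V -> R[i]) : Prop :=
  SemiInner {
  semi_innerDl : forall x y z, s (x + y) z = s x z + s y z;
  semi_innerZl : forall c x z, s (c *: x) z = c * s x z;
  semi_innerC : forall x y, s x y = (s y x)^*;
  semi_inner_ge0 : forall x, 0 <= complex.Re (s x x) }.

Arguments semi_innerDl {R V s}.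
Arguments semi_innerZl {R V s}.
Arguments semi_innerC {R V s}.
Arguments semi_inner_ge0 {R V s}.

Section SemiInner.
Context {R : realType} {V : lmodType R[i]} {s : V -> V -> R[i]} (ss : semi_inner s).
Local Notation q x := (complex.Re (s x x)).
Local Notation rho x y := (complex.Re (s x y)).

Lemma rhoDl x y z : rho (x + y) z = rho x z + rho y z.
Proof. by rewrite (semi_innerDl ss); case: (s x z) (s y z) => [? ?] []. Qed.

Lemma rhoC x y : rho x y = rho y x.
Proof. by rewrite (semi_innerC ss); case: (s y x). Qed.

Lemma rhoDr x y z : rho z (x + y) = rho z x + rho z y.
Proof. by rewrite !(rhoC z) rhoDl. Qed.

Lemma rhoZl (t : R) x z : rho (t%:C *: x) z = t * rho x z.
Proof. by rewrite (semi_innerZl ss); case: (s x z) => a b /=; ring. Qed.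

Lemma rhoZr (t : R) x z : rho z (t%:C *: x) = t * rho z x.
Proof. by rewrite !(rhoC z) rhoZl. Qed.

Lemma sqnormZ c x : q (c *: x) = (complex.Re c ^+ 2 + complex.Im c ^+ 2) * q x.
Proof.
have -> : s (c *: x) (c *: x) = c * c^* * s x x.
  rewrite (semi_innerZl ss) (semi_innerC ss) (semi_innerZl ss) rmorphM/=.
  by rewrite -(semi_innerC ss) mulrA.
have : complex.Im (s x x) = 0.
  by have := semi_innerC ss x x; case: (s x x) => a b [] /=; lra.
by case: c (s x x) => a b [u v] /= ->; ring.
Qed.

Lemma sqnormD x y : q (x + y) = q x + q y + 2 * rho x y.
Proof. by rewrite rhoDl !rhoDr (rhoC y x); ring. Qed.

Lemma rhoNl x y : rho (- x) y = - rho x y.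
Proof.
have -> : - x = (- 1 : R)%:C *: x by rewrite rmorphN rmorph1 scaleN1r.
by rewrite rhoZl mulN1r.
Qed.

Lemma rhoNr x y : rho x (- y) = - rho x y.
Proof. by rewrite !(rhoC x) rhoNl. Qed.

Lemma sqnormN x : q (- x) = q x.
Proof. by rewrite rhoNl rhoNr opprK. Qed.

Lemma sqnormB x y : q (x - y) = q x + q y - 2 * rho x y.
Proof. by rewrite sqnormD sqnormN rhoNr mulrN. Qed.

(** Parallelogram law with the term [q (x - y)] dropped. *)
Lemma sqnormD_le x y : q (x + y) <= 2 * q x + 2 * q y.
Proof. by have := semi_inner_ge0 ss (x - y); rewrite sqnormB sqnormD; lra. Qed.

Lemma sqnormB_le x y : q (x - y) <= 2 * q x + 2 * q y.
Proof. by have := sqnormD_le x (- y); rewrite sqnormN. Qed.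

(** Discriminant of the nonnegative quadratic [t |-> q (x + t y)] in a real variable [t]. *)
Lemma cauchy_schwarz x y : rho x y ^+ 2 <= q x * q y.
Proof.
apply: quad_ge0_discr => [|t]; first exact: semi_inner_ge0 ss y.
have := semi_inner_ge0 ss (x + t%:C *: y).
by rewrite sqnormD sqnormZ rhoZr/= expr0n addr0 addrAC.
Qed.

(** Since [Re (i w) = - Im w], real parts at [x] and at [i x] determine a value that is linear in
    [x]. *)
Lemma semi_inner_eq_Re x m (z : R[i]) :
  rho x m = complex.Re z -> rho ('i *: x) m = complex.Re ('i * z) -> s x m = z.
Proof.
rewrite (semi_innerZl ss); case: (s x m) z => a b [c d] /= -> h.
by congr (_ +i* _); move: h; rewrite !mul0r !mul1r; lra.
Qed.

End SemiInner.

(** * Norm, closure and completeness expressed by real squared norms *)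

Section Hilbert.
Context {R : realType} {H : completeNormedModType R[i]}.
Context {dot : {dot H for (@Num.conj R[i])}} (dot_norm : induces_norm dot).
Local Notation q x := (complex.Re (dot x x)).
Local Notation rho x y := (complex.Re (dot x y)).

Lemma dot_semi_inner : semi_inner dot.
Proof.
split=> [x y z|c x z|x y|x].
- by rewrite linearDl.
- by rewrite linearZl_LR.
- by rewrite hermC expr0 mul1r.
- by rewrite -dot_norm; have := exprn_ge0 2 (normr_ge0 x); rewrite lecE => /andP[].
Qed.

Local Notation ds := dot_semi_inner.

Lemma norm_complexE (x : H) : `|x| = (complex.Re `|x|)%:C.
Proof. by rewrite RRe_real// normr_real. Qed.

Lemma Re_norm_ge0 (x : H) : 0 <= complex.Re `|x|.
Proof. by have := normr_ge0 x; rewrite norm_complexE ler0c. Qed.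

Lemma sqnormE x : q x = complex.Re `|x| ^+ 2.
Proof. by rewrite -dot_norm norm_complexE -rmorphXn. Qed.

Lemma sqnorm_lt x (e : R) : 0 < e -> (q x < e ^+ 2) = (`|x| < e%:C).
Proof.
move=> e0; rewrite sqnormE norm_complexE ltcR ltr_pXn2r// nnegrE ?Re_norm_ge0//.
exact: ltW.
Qed.

Lemma sqnorm_eq0 x : q x = 0 -> x = 0.
Proof.
move/eqP; rewrite sqnormE expf_eq0/= => /eqP x0.
by apply/eqP; rewrite -normr_eq0 norm_complexE x0.
Qed.

Lemma bounded_sqnormP (T : H -> H) :
  (exists c : R, forall x, `|T x| <= c%:C * `|x|) <->
  (exists2 c : R, 0 <= c & forall x, q (T x) <= c * q x).
Proof.
split=> [[c cT]|[c c0 cT]].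
  exists (c ^+ 2) => [|x]; first exact: sqr_ge0.
  have := cT x; rewrite !sqnormE (norm_complexE x) (norm_complexE (T x)).
  rewrite -rmorphM/= lecR -exprMn => h; rewrite lerXn2r ?nnegrE ?Re_norm_ge0//.
  by apply: le_trans h; rewrite Re_norm_ge0.
exists (Num.sqrt c) => x; rewrite (norm_complexE x) (norm_complexE (T x)).
rewrite -rmorphM/= lecR; have := cT x; rewrite !sqnormE -{1}(sqr_sqrtr c0) -exprMn.
by rewrite ler_pXn2r ?nnegrE ?mulr_ge0 ?Re_norm_ge0// sqrtr_ge0.
Qed.

Lemma closure_sqnormP (N : set H) m :
  closure N m <-> forall e : R, 0 < e -> exists2 n, N n & q (m - n) < e.
Proof.
split=> [Nm e e0|h B].
  have se0 : 0 < Num.sqrt e by rewrite sqrtr_gt0.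
  have /Nm[n [Nn]] : nbhs m (ball m (Num.sqrt e)%:C).
    by apply: nbhsx_ballx; rewrite ltcR.
  rewrite -ball_normE/= -sqnorm_lt// sqr_sqrtr 1?ltW// => mn.
  by exists n.
rewrite -nbhs_ballE => -[_ /= /gt0_complexE[e e0 ->] eB].
have [n Nn mn] := h (e ^+ 2) (exprn_gt0 _ e0).
exists n; split=> //; apply: eB; rewrite -ball_normE/=.
by rewrite -sqnorm_lt.
Qed.

Lemma closureP_lin (N : set H) (c : R[i]) m n :
  (forall (a : R[i]) x y, N x -> N y -> N (a *: x + y)) ->
  closure N m -> closure N n -> closure N (c *: m + n).
Proof.
move=> Nlin /closure_sqnormP hm /closure_sqnormP hn; apply/closure_sqnormP => e e0.
set k := complex.Re c ^+ 2 + complex.Im c ^+ 2.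
have k0 : 0 <= k by rewrite addr_ge0 ?sqr_ge0.
(* The error is at most [2 k q (m - x) + 2 q (n - y)], and each half is to stay within [e / 2];
   [k + 1] avoids a division by zero when [c = 0]. *)
have d0 : 0 < e / (4 * (k + 1)) by rewrite divr_gt0// mulr_gt0// ltr_wpDl.
have [x Nx mx] := hm _ d0.
have e4 : 0 < e / 4 by rewrite divr_gt0.
have [y Ny ny] := hn _ e4.
exists (c *: x + y); first exact: Nlin.
have -> : c *: m + n - (c *: x + y) = c *: (m - x) + (n - y).
  by rewrite scalerBr opprD addrACA.
apply: le_lt_trans (sqnormD_le ds _ _) _; rewrite (sqnormZ ds) -/k.
have h : k * q (m - x) <= e / 4.
  apply: (@le_trans _ _ (k * (e / (4 * (k + 1))))); first by rewrite ler_wpM2l// ltW.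
  have -> : k * (e / (4 * (k + 1))) = e / 4 * (k / (k + 1)).
    by field; rewrite gt_eqF// ltr_wpDl.
  by apply: ler_piMr; [exact: ltW|]; rewrite ler_pdivrMr ?ltr_wpDl// mul1r lerDl.
by lra.
Qed.

(** The rate is the one that the parallelogram law yields for a sequence minimizing a functional up
    to [1 / (k + 1)]. *)
Lemma sqnorm_cauchy_cvg (x : nat -> H) :
  (forall k l, q (x k - x l) <= 2 / k.+1%:R + 2 / l.+1%:R) ->
  exists m, forall e : R, 0 < e -> \forall k \near \oo, q (m - x k) < e.
Proof.
move=> xC.
have : cauchy (x @ \oo).
  apply/cauchy_ballP => _ /gt0_complexE[e e0 ->].
  have d0 : 0 < e ^+ 2 / 4 by rewrite divr_gt0// exprn_gt0.
  have hk := near_infty_natSinv_lt (PosNum d0).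
  rewrite near_map2; near=> k l.
  rewrite -ball_normE/= -sqnorm_lt//.
  apply: le_lt_trans (xC _ _) _.
  have : k.+1%:R^-1 < e ^+ 2 / 4 by near: k.
  have : l.+1%:R^-1 < e ^+ 2 / 4 by near: l.
  by move: k.+1%:R^-1 l.+1%:R^-1 => a b; lra.
move/cauchy_cvgP/cvg_ex => [m /cvgrPdist_lt mP].
exists m => e e0.
have se0 : 0 < Num.sqrt e by rewrite sqrtr_gt0.
have := mP (Num.sqrt e)%:C; rewrite ltcR => /(_ se0).
apply: filterS => k; rewrite -sqnorm_lt// sqr_sqrtr//; exact: ltW.
Unshelve. all: by end_near. Qed.

End Hilbert.

(** * Riesz representation, adjoints and projections *)

Section Riesz.
Context {R : realType} {H : completeNormedModType R[i]}.
Context {dot : {dot H for (@Num.conj R[i])}} (dot_norm : induces_norm dot).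
Local Notation q x := (complex.Re (dot x x)).
Local Notation rho x y := (complex.Re (dot x y)).
Local Notation ds := (dot_semi_inner dot_norm).

(* A minimizing sequence of [q x - 2 f x] over [N] is Cauchy, by the
   parallelogram law, and its limit represents [f] on [N]. *)
Lemma riesz_Re (N : set H) (f : H -> R) (c : R) :
  N 0 -> (forall (a : R) x y, N x -> N y -> N (a%:C *: x + y)) ->
  (forall (a : R) x y, f (a%:C *: x + y) = a * f x + f y) ->
  (forall x, f x ^+ 2 <= c * q x) ->
  exists2 m, closure N m & forall x, N x -> rho x m = f x.
Proof.
move=> N0 Nlin flin fc.
have NZ (a : R) x : N x -> N (a%:C *: x).
  by move=> Nx; rewrite -[_ *: _]addr0; exact: Nlin.
have ND x y : N x -> N y -> N (x + y).
  by move=> Nx Ny; rewrite -[x]scale1r -[1]/(1%:C); exact: Nlin.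
have fD x y : f (x + y) = f x + f y.
  by rewrite -[x in LHS]scale1r -[1]/(1%:C) flin mul1r.
have f0 : f 0 = 0 by have := fD 0 0; rewrite addr0; lra.
have fZ (a : R) x : f (a%:C *: x) = a * f x.
  by rewrite -[_ *: _]addr0 flin f0 addr0.
pose J x := q x - 2 * f x.
have J_lb : has_lbound (J @` N).
  exists (- `|c|) => _ [x _ <-]; rewrite /J.
  have q0 := semi_inner_ge0 ds x.
  have : f x ^+ 2 <= `|c| * q x.
    by apply: le_trans (fc x) _; rewrite ler_wpM2r// ler_norm.
  (* From [u ^ 2 <= d p] follows [2 u <= p + d]: otherwise [4 u ^ 2 > (p + d) ^ 2 >= 4 d p]. *)
  have := normr_ge0 c; move: `|c| (q x) (f x) q0 => d p u p0 d0 h.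
  suff : 2 * u <= p + d by lra.
  rewrite leNgt; apply/negP => h'.
  have k1 : 0 < 2 * u - (p + d) by lra.
  have k2 : 0 < 2 * u + (p + d) by lra.
  by have := mulr_gt0 k1 k2; have := sqr_ge0 (p - d); lra.
have J_inf : has_inf (J @` N) by split=> //; exists (J 0), 0.
set I := inf (J @` N).
have I_le x : N x -> I <= J x by move=> Nx; apply: ge_inf => //; exists x.
have /choice[x xP] k : exists x, N x /\ J x < I + k.+1%:R^-1.
  have [|_ [x Nx <-] xk] := @inf_adherent _ (J @` N) k.+1%:R^-1 _ J_inf.
    by rewrite invr_gt0.
  by exists x.
have xN k : N (x k) by case: (xP k).
have xJ k : J (x k) < I + k.+1%:R^-1 by case: (xP k).
have [k l|m mP] := @sqnorm_cauchy_cvg _ _ _ dot_norm x.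
  (* Compare with the midpoint [z] of [x k] and [x l]: [q (x k - x l) = 2 J (x k) + 2 J (x l) - 4 J
     z], where [J z >= I]. *)
  have := I_le _ (NZ 2^-1 _ (ND _ _ (xN k) (xN l))).
  have := xJ k; have := xJ l.
  rewrite /J (sqnormZ ds) fZ (sqnormB ds) (sqnormD ds) fD/= expr0n/= addr0.
  by move: k.+1%:R^-1 l.+1%:R^-1 => a b; lra.
(* Near-stationarity: [J (t y + x k) >= I > J (x k) - 1 / (k + 1)] for all real [t], so a quadratic
   in [t] stays nonnegative and its discriminant gives the bound. *)
have gap y k : N y -> (rho y (x k) - f y) ^+ 2 <= q y * k.+1%:R^-1.
  move=> Ny; rewrite mulrC; apply: quad_ge0_discr => [|t].
    exact: semi_inner_ge0 ds y.
  have := I_le _ (Nlin t y (x k) Ny (xN k)); have := xJ k.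
  rewrite /J (sqnormD ds) flin (sqnormZ ds) (rhoZl ds)/= expr0n/= addr0.
  by move: k.+1%:R^-1 => a; lra.
exists m.
  apply/(closure_sqnormP dot_norm) => e e0.
  near \oo => k; exists (x k) => //.
  by near: k; exact: mP.
move=> y Ny; apply/eqP; rewrite -subr_eq0 -sqrf_eq0 eq_le sqr_ge0 andbT.
apply/ler_addgt0Pl => e e0; rewrite addr0.
have qy0 := semi_inner_ge0 ds y.
have d0 : 0 < e / (4 * (q y + 1)) by rewrite divr_gt0// mulr_gt0// ltr_wpDl.
near \oo => k.
have h1 : k.+1%:R^-1 < e / (4 * (q y + 1)).
  by near: k; exact: (near_infty_natSinv_lt (PosNum d0)).
have h2 : q (m - x k) < e / (4 * (q y + 1)) by near: k; exact: mP.
(* Split [rho y m - f y] at [rho y (x k)]; each square is at most [e / 4], and the square of a sum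
   is at most twice the sum of squares. *)
have := cauchy_schwarz ds y (m - x k); have := gap y k Ny.
rewrite (rhoDr ds) (rhoNr ds).
have h (d : R) : d < e / (4 * (q y + 1)) -> q y * d <= e / 4.
  move=> /ltW /(ler_wpM2l qy0) /le_trans; apply.
  have -> : q y * (e / (4 * (q y + 1))) = e / 4 * (q y / (q y + 1)).
    by field; rewrite gt_eqF// ltr_wpDl.
  apply: ler_piMr; first by rewrite ltW// divr_gt0.
  by rewrite ler_pdivrMr ?ltr_wpDl// mul1r lerDl.
have := h _ h1; have := h _ h2.
move: (q y * _) (q y * _) (rho y m) (rho y (x k)) (f y) => a b u v w.
by have := sqr_ge0 (u - 2 * v + w); lra.
Unshelve. all: by end_near. Qed.

(** The real version represents the real part of [f], and complex linearity does the rest. With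
    [N = setT] this produces adjoints, with a general subspace projections onto its closure. *)
Lemma riesz (N : set H) (f : H -> R[i]) (c : R) :
  N 0 -> (forall a x y, N x -> N y -> N (a *: x + y)) ->
  scalar f -> (forall x, complex.Re (f x) ^+ 2 <= c * q x) ->
  exists2 m, closure N m & forall x, N x -> dot x m = f x.
Proof.
move=> N0 Nlin flin fc.
have [||m Nm mP] := @riesz_Re N (fun x => complex.Re (f x)) c N0 _ _ fc.
- by move=> a x y; exact: Nlin.
- by move=> a x y; rewrite flin; case: (f x) (f y) => u v [u' v'] /=; ring.
exists m => // x Nx; apply: (semi_inner_eq_Re ds); first exact: mP.
have f0 : f 0 = 0 by exact: (@linear_at0 _ _ R[i]^o _ flin).
have iE : 'i *: x = 'i *: x + 0 by rewrite addr0.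
by rewrite mP iE; [rewrite flin f0 addr0|exact: Nlin].
Qed.

Lemma dot_inj x y : (forall z, dot z x = dot z y) -> x = y.
Proof.
move=> xy; apply/eqP; rewrite -subr_eq0; apply/eqP/(sqnorm_eq0 dot_norm).
by rewrite (rhoDr ds) (rhoNr ds) xy subrr.
Qed.

Lemma dotDr x y z : dot z (x + y) = dot z x + dot z y.
Proof. by rewrite linearDr. Qed.

Lemma dotZr c x z : dot z (c *: x) = c^* * dot z x.
Proof. by rewrite linearZr_LR. Qed.

Lemma adjointP (T : H -> H) : bounded_operators T ->
  bounded_operators (adjoint dot T) /\
  forall x y, dot (T x) y = dot x (adjoint dot T y).
Proof.
move=> [Tlin /(bounded_sqnormP dot_norm)[c c0 cT]].
suff : exists S, bounded_operators S /\ forall x y, dot (T x) y = dot x (S y).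
  by move=> [S SP]; rewrite /adjoint; case: xgetP => [_ -> //|/(_ S)].
have /choice[S SP] y : exists m, forall x, dot (T x) y = dot x m.
  have [//|//|x|m _ mP] := @riesz setT (fun x => dot (T x) y) (c * q y) I _.
  - by move=> a u v; rewrite Tlin (semi_innerDl ds) (semi_innerZl ds).
  - apply: le_trans (cauchy_schwarz ds _ _) _.
    by rewrite mulrAC ler_wpM2r// (semi_inner_ge0 ds).
  - by exists m => x; rewrite mP.
exists S; split; last by move=> x y; exact: SP.
split.
  move=> a x y; apply: dot_inj => z.
  by rewrite dotDr dotZr -!SP dotDr dotZr.
apply/(bounded_sqnormP dot_norm); exists c => // x.
(* This reads [q (S x) ^ 2 <= q (T (S x)) * q x <= c * q (S x) * q x]; divide by [q (S x)] unless it
   vanishes. *)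
have /= := cauchy_schwarz ds (T (S x)) x; rewrite SP => h.
have := cT (S x); have := semi_inner_ge0 ds (S x); have := semi_inner_ge0 ds x.
move: h; move: (q (S x)) (q x) (q (T (S x))) => u v w h v0 u0 wu.
have [->|u1] := eqVneq u 0; first exact: mulr_ge0.
have u2 : 0 < u by rewrite lt_neqAle eq_sym u1.
rewrite -(ler_pM2l u2) -expr2 (le_trans h)// mulrA [u * c]mulrC.
by rewrite ler_wpM2r.
Qed.

(** [P y] represents [dot _ y] on [N]. Orthogonality to [N] extends to its closure, which yields
    both linearity and the bound. *)
Lemma closure_projection (N : set H) :
  N 0 -> (forall a x y, N x -> N y -> N (a *: x + y)) ->
  exists2 P : H -> H, bounded_operators P & forall y,
    closure N (P y) /\ forall x, N x -> dot x (P y) = dot x y.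
Proof.
move=> N0 Nlin.
have /choice[P PP] y : exists m, closure N m /\ forall x, N x -> dot x m = dot x y.
  have [//|x|m Nm mP] := @riesz N (fun x => dot x y) (q y) N0 Nlin.
  - by move=> a u v; rewrite (semi_innerDl ds) (semi_innerZl ds).
  - by rewrite mulrC; exact: cauchy_schwarz ds _ _.
  - by exists m.
exists P => [|y]; last exact: PP.
have closure_orth m d : closure N m -> (forall x, N x -> dot x d = 0) -> rho m d = 0.
  move=> /(closure_sqnormP dot_norm) Nm dN.
  apply/eqP; rewrite -sqrf_eq0 eq_le sqr_ge0 andbT.
  apply/ler_addgt0Pl => e e0; rewrite addr0.
  have qd0 := semi_inner_ge0 ds d.
  have d0 : 0 < e / (q d + 1) by rewrite divr_gt0// ltr_wpDl.
  have [n Nn mn] := Nm _ d0.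
  have -> : rho m d = rho (m - n) d by rewrite (rhoDl ds) (rhoNl ds) (dN _ Nn) subr0.
  apply: le_trans (cauchy_schwarz ds _ _) _.
  apply: le_trans (ler_wpM2r qd0 (ltW mn)) _.
  have -> : e / (q d + 1) * q d = e * (q d / (q d + 1)).
    by field; rewrite gt_eqF// ltr_wpDl.
  apply: ler_piMr; first exact: ltW.
  by rewrite ler_pdivrMr ?ltr_wpDl// mul1r lerDl.
split.
  (* The defect of linearity lies in the closure of [N] and is orthogonal to [N], hence to
     itself. *)
  move=> a x y; apply/eqP; rewrite -subr_eq0; apply/eqP/(sqnorm_eq0 dot_norm).
  apply: closure_orth => [|z Nz].
    have [[[Nx _] [Ny _]] [Nxy _]] := (PP x, PP y, PP (a *: x + y)).
    rewrite -scaleN1r [X in closure N X]addrC; apply: (closureP_lin dot_norm) => //.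
    exact: (closureP_lin dot_norm).
  have [[[_ Ex] [_ Ey]] [_ Exy]] := (PP x, PP y, PP (a *: x + y)).
  by rewrite linearBr/= !dotDr dotZr Ex// Ey// Exy// dotDr dotZr subrr.
apply/(bounded_sqnormP dot_norm); exists 1 => // x.
have [Nx Ex] := PP x.
(* Pythagoras: [q (P x - x) = q x - q (P x)]. *)
have : rho (P x) (P x - x) = 0.
  by apply: closure_orth => // z Nz; rewrite linearBr/= Ex// subrr.
have := semi_inner_ge0 ds (P x - x).
by rewrite (sqnormB ds) (rhoDr ds) (rhoNr ds); lra.
Qed.

End Riesz.

(** * Powers, angles and suprema of real numbers *)

Lemma expr_bounded_le1 (R : realType) (r K : R) :
  0 <= r -> (forall k, r ^+ (2 ^ k)%N <= K) -> r <= 1.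
Proof.
move=> r0 rK; rewrite leNgt; apply/negP => r1.
have bernoulli n : 1 + n%:R * (r - 1) <= r ^+ n.
  elim: n => [|n ih]; first by rewrite mul0r addr0.
  rewrite exprS; apply: le_trans (ler_wpM2l r0 ih).
  rewrite -natr1; have : 0 <= n%:R :> R by [].
  by move: (n%:R : R) => m m0; have := mulr_ge0 m0 (sqr_ge0 (r - 1)); lra.
(* If [r > 1], Bernoulli at the exponent [2 ^ (n + 1) >= n + 1] already exceeds [K]. *)
set n := Num.truncn (K / (r - 1)).
have nK : K < n.+1%:R * (r - 1) by rewrite -ltr_pdivrMr ?subr_gt0// truncnS_gt.
have := rK n.+1; apply/negP; rewrite -ltNge.
apply: lt_le_trans (bernoulli _).
have h : n.+1%:R <= (2 ^ n.+1)%:R :> R by rewrite ler_nat ltnW// ltn_expl.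
have r1' : 0 <= r - 1 by rewrite subr_ge0 ltW.
by have := ler_wpM2r r1' h; lra.
Qed.

(** [theta] is an argument of [a + i b]. As [acos] only gives angles with nonnegative sine, its sign
    is flipped when [b < 0]. *)
Lemma exists_angle (R : realType) (a b : R) :
  exists theta : R, cos theta * a + sin theta * b = Num.sqrt (a ^+ 2 + b ^+ 2).
Proof.
set n := Num.sqrt _.
have n2 : n ^+ 2 = a ^+ 2 + b ^+ 2 by rewrite sqr_sqrtr// addr_ge0 ?sqr_ge0.
have [n0|n0] := eqVneq n 0.
  exists 0; rewrite cos0 sin0 mul1r mul0r addr0 n0.
  apply/eqP; rewrite -sqrf_eq0 eq_le sqr_ge0 andbT.
  by move: n2; rewrite n0 expr0n/=; have := sqr_ge0 b; lra.
have np : 0 < n by rewrite lt_neqAle eq_sym n0 sqrtr_ge0.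
have e : 1 - (a / n) ^+ 2 = (b / n) ^+ 2.
  rewrite !expr_div_n; apply: (mulIf (expf_neq0 2 n0)).
  by rewrite mulrBl !divfK ?expf_neq0// n2; ring.
have an : -1 <= a / n <= 1.
  have : 0 <= 1 - (a / n) ^+ 2 by rewrite e sqr_ge0.
  by move: (a / n) => x x1; apply/andP; split; nra.
have c : cos (acos (a / n)) = a / n by exact: acosK.
have s : sin (acos (a / n)) = `|b / n| by rewrite sin_acos// e sqrtr_sqr.
have [b0|b0] := leP 0 (b / n).
  exists (acos (a / n)); rewrite c s ger0_norm//.
  by rewrite mulrAC [b / n * b]mulrAC -mulrDl -!expr2 -n2 expr2 mulfK.
exists (- acos (a / n)); rewrite cosN sinN c s ltr0_norm// opprK.
by rewrite mulrAC [b / n * b]mulrAC -mulrDl -!expr2 -n2 expr2 mulfK.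
Qed.

(** The empty set is allowed, with supremum 0; this covers [A = 0], where there are no unit
    vectors. *)
Lemma sup_ge0_le (R : realType) (E : set R) (c : R) : 0 <= c ->
  (forall y, E y -> 0 <= y <= c) -> 0 <= sup E <= c.
Proof.
move=> c0 Ec; have [->|/set0P[y Ey]] := eqVneq E set0; first by rewrite sup0 lexx.
have Ub : ubound E c by move=> z /Ec /andP[].
apply/andP; split; last by apply: ge_sup => //; exists y.
have /andP[y0 _] := Ec _ Ey.
by apply: le_trans y0 _; apply: ub_le_sup => //; exists c.
Qed.

Lemma le_sup_range (R : realType) (F : R -> R) (M t : R) :
  (forall u, F u <= M) -> F t <= sup (range F).
Proof.
move=> FM; apply: ub_le_sup; last by exists t.
by exists M => _ [u _ <-].
Qed.

(** * The semi-inner product of [A], its operator seminorm and [dw] *)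

Section AForm.
Context {R : realType} {H : completeNormedModType R[i]}.
Context {dot : {dot H for (@Num.conj R[i])}} (dot_norm : induces_norm dot).
Context {A : H -> H} (A_psd : psd_operator dot A).
Local Notation q x := (complex.Re (dot x x)).
Local Notation ds := (dot_semi_inner dot_norm).
Local Notation s := (A_dot dot A).
Local Notation p x := (complex.Re (A_dot dot A x x)).

Lemma A_dot_semi_inner : semi_inner s.
Proof.
have [[Alin _] A0] := A_psd.
have sD x y z : s (x + y) z = s x z + s y z.
  by rewrite /A_dot -[x]scale1r Alin !scale1r (semi_innerDl ds).
have A00 := linear_at0 Alin.
have sZ c x z : s (c *: x) z = c * s x z.
  by rewrite /A_dot -[c *: x]addr0 Alin A00 addr0 (semi_innerZl ds).
have sDr x y z : s z (x + y) = s z x + s z y by rewrite /A_dot dotDr.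
have sZr c x z : s z (c *: x) = c^* * s z x by rewrite /A_dot dotZr.
have s_real x : complex.Im (s x x) = 0 by apply: ger0_Im; exact: A0.
split=> // [x y|x].
(* Polarization: the form is real on the diagonal, and its values at [x + y] and [i x + y] give the
   imaginary and the real part of the symmetry. *)
- have := s_real (x + y); rewrite !sD !sDr.
  have := s_real ('i *: x + y); rewrite !sD !sDr !sZ !sZr.
  have := s_real x; have := s_real y.
  case: (s x y) (s y x) (s x x) (s y y) => [a b] [c d] [e f] [g h] /= -> -> h1 h2.
  by congr (_ +i* _); lra.
- by have := A0 x; rewrite lecE/= => /andP[].
Qed.

Local Notation ss := A_dot_semi_inner.

Lemma A_dotC_dot x y : dot x (A y) = dot (A x) y.
Proof.
have := semi_innerC ss x y; rewrite /A_dot => ->.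
by rewrite (semi_innerC ds x).
Qed.

Lemma A_sqnorm_bound : exists2 c : R, 0 <= c & forall x, p x <= c * q x.
Proof.
have [[_ /(bounded_sqnormP dot_norm)[c c0 Ac]] _] := A_psd.
exists (c + 1); first by rewrite addr_ge0.
(* Expanding gives [2 * p x <= q (A x) + q x <= (c + 1) * q x]. *)
move=> x; have := semi_inner_ge0 ds (A x - x); rewrite (sqnormB ds).
have := semi_inner_ge0 ds (A x + x); rewrite (sqnormD ds).
have := Ac x; have := semi_inner_ge0 ds x; have := mulr_ge0 c0 (semi_inner_ge0 ds x).
by rewrite /A_dot; move: (q x) (q (A x)) => u v; lra.
Qed.

(* Krein-Lax: [p (U^n x) = Re (s x (U^(2n) x))], so Cauchy-Schwarz gives
   [p (U^n x) ^ 2 <= p (U^(2n) x)] on unit vectors, hence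
   [p (U x) ^ (2^k) <= p (U^(2^k) x)], which is bounded by a constant times
   [c ^ (2^k)]. *)
Lemma A_selfadjoint_bound (U : H -> H) (c : R) : 0 < c ->
  (forall x, q (U x) <= c * q x) -> (forall x y, s (U x) y = s x (U y)) ->
  forall x, p x = 1 -> p (U x) <= c.
Proof.
move=> c0 Uc Usym x px.
have [a a0 pa] := A_sqnorm_bound.
have iterU n y z : s (iter n U y) z = s y (iter n U z).
  by elim: n y z => [//|n ih] y z; rewrite iterS Usym ih -iterSr.
have double n : p (iter n U x) ^+ 2 <= p (iter (n + n) U x).
  by have := cauchy_schwarz ss x (iter (n + n) U x); rewrite px mul1r iterD -iterU.
have pow k : p (U x) ^+ (2 ^ k)%N <= p (iter (2 ^ k) U x).
  elim: k => [|k ih]; first by rewrite expr1.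
  rewrite expnSr exprM muln2 -addnn; apply: le_trans (double _).
  by rewrite lerXn2r// nnegrE ?exprn_ge0// (semi_inner_ge0 ss).
have iterq n : q (iter n U x) <= c ^+ n * q x.
  elim: n => [|n ih]; first by rewrite mul1r.
  apply: le_trans (Uc _) _; rewrite exprS -mulrA ler_wpM2l//; exact: ltW.
suff : p (U x) / c <= 1 by rewrite ler_pdivrMr// mul1r.
apply: (@expr_bounded_le1 _ _ (a * q x)) => [|k].
  by rewrite divr_ge0 ?(semi_inner_ge0 ss)// ltW.
rewrite expr_div_n ler_pdivrMr ?exprn_gt0//.
apply: le_trans (pow k) _; apply: le_trans (pa _) _.
by rewrite -mulrA ler_wpM2l// [leRHS]mulrC.
Qed.

Lemma A_norm_eq1 x : (A_norm dot A x = 1) <-> (p x = 1).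
Proof.
rewrite /A_norm; split=> [h|->]; last exact: sqrtr1.
by rewrite -[LHS]sqr_sqrtr ?h ?expr1n// (semi_inner_ge0 ss).
Qed.

Lemma A_opnorm_sqr_le (D : H -> H) (K : R) : 0 <= K ->
  (forall x, p x = 1 -> p (D x) <= K) ->
  0 <= A_opnorm dot A D <= Num.sqrt K.
Proof.
move=> K0 DK; apply: sup_ge0_le; first exact: sqrtr_ge0.
move=> _ [x /A_norm_eq1 px <-]; rewrite sqrtr_ge0/= ler_wsqrtr//.
exact: DK.
Qed.

(** Cauchy-Schwarz against the unit vector [x]; [K] serves only to make the supremum finite. *)
Lemma A_opnorm_numrange (D : H -> H) (K : R) (x : H) :
  (forall x, p x = 1 -> p (D x) <= K) -> p x = 1 ->
  `|complex.Re (s (D x) x)| <= A_opnorm dot A D.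
Proof.
move=> DK px; apply: (@le_trans _ _ (A_norm dot A (D x))).
  rewrite -sqrtr_sqr ler_wsqrtr//.
  by have := cauchy_schwarz ss (D x) x; rewrite px mulr1.
apply: ub_le_sup; last by exists x => //; exact/A_norm_eq1.
by exists (Num.sqrt K) => _ [y /A_norm_eq1 py <-]; rewrite ler_wsqrtr// DK.
Qed.

Lemma dw_sqr_le (T : H -> H) (M : R) : 0 <= M ->
  (forall x, p x = 1 ->
    complex.Re (s (T x) x) ^+ 2 + complex.Im (s (T x) x) ^+ 2 + p (T x) ^+ 2 <= M) ->
  dw dot A T ^+ 2 <= M.
Proof.
move=> M0 TM.
suff /andP[d0 dM] : 0 <= dw dot A T <= Num.sqrt M.
  by rewrite -[leRHS]sqr_sqrtr// lerXn2r ?nnegrE ?sqrtr_ge0.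
apply: sup_ge0_le => [|_ [x /A_norm_eq1 px <-]]; first exact: sqrtr_ge0.
rewrite normc_def sqrtr_ge0 ler_wsqrtr//= sqr_sqrtr ?addr_ge0 ?sqr_ge0//.
rewrite (exprM _ 2 2) /A_norm sqr_sqrtr; first exact: TM.
exact: semi_inner_ge0 ss _.
Qed.

(** * The A-adjoint and A-boundedness *)

Context {T : H -> H} (T_BA : A_adjointable dot A T).
Local Notation S := (sharp dot A T).

(** Any A-adjoint [X] is corrected to [P \o X], with [P] the projection onto the closure of the
    range of [A]. Since [P] preserves products with vectors [A z] and [A] is self-adjoint,
    [A \o P = A]. *)
Lemma sharpP : A_adjoints dot A T S.
Proof.
suff : exists X, A_adjoints dot A T X /\ range X `<=` closure (range A).
  by move=> [X XP]; rewrite /sharp; case: xgetP => [_ -> []//|/(_ X)].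
have [_ [X [[Xlin /(bounded_sqnormP dot_norm)[c c0 Xc]] AX]]] := T_BA.
have [[Alin _] _] := A_psd.
have [||P [Plin /(bounded_sqnormP dot_norm)[d d0 Pd]] PP] :=
  @closure_projection _ _ _ dot_norm (range A).
- by exists 0 => //; exact: linear_at0.
- by move=> a _ _ [x _ <-] [y _ <-]; exists (a *: x + y) => //; exact: Alin.
exists (P \o X); split; last by move=> _ [x _ <-]; exact: (PP (X x)).1.
split; [split|].
- by move=> a x y /=; rewrite Xlin Plin.
- apply/(bounded_sqnormP dot_norm); exists (d * c); first exact: mulr_ge0.
  move=> x /=; apply: le_trans (Pd _) _.
  by rewrite -mulrA ler_wpM2l.
- rewrite -AX; apply: funext => x; apply: (dot_inj dot_norm) => z /=.
  by rewrite !A_dotC_dot (PP (X x)).2//; exists z.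
Qed.

Lemma sharp_adjointl x y : s (S x) y = s x (T y).
Proof.
have [_ AS] := sharpP; have [TB _] := T_BA.
have [_ adjP] := adjointP dot_norm _ TB.
rewrite /A_dot -[A (S x)]/((A \o S) x) AS/=.
by rewrite (semi_innerC ds) -adjP -(semi_innerC ds).
Qed.

Lemma sharp_adjointr x y : s x (S y) = s (T x) y.
Proof. by rewrite (semi_innerC ss) sharp_adjointl -(semi_innerC ss). Qed.

Lemma A_comp_bound (U V : H -> H) : bounded_operators U -> bounded_operators V ->
  (forall x y, s (U (V x)) y = s x (U (V y))) ->
  exists2 c : R, 0 <= c & forall x, p x = 1 -> p (U (V x)) <= c.
Proof.
move=> [_ /(bounded_sqnormP dot_norm)[c c0 Uc]] [_ /(bounded_sqnormP dot_norm)[d d0 Vd]].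
move=> UVsym.
have cd : 0 < c * d + 1 by rewrite ltr_wpDl// mulr_ge0.
(* The added 1 makes the constant positive, as [A_selfadjoint_bound] demands. *)
exists (c * d + 1); first exact: ltW.
apply: (@A_selfadjoint_bound (U \o V)) => // x /=.
apply: le_trans (Uc _) _; rewrite mulrDl mul1r.
rewrite -mulrA -[leLHS]addr0 lerD ?(semi_inner_ge0 ds)//.
by rewrite ler_wpM2l.
Qed.

(** [S \o T] and [T \o S] are A-symmetric, hence A-bounded. On unit vectors [p (T x)] is the value
    of the form at [S (T x)] and [x], so [p (T x) ^ 2 <= p (S (T x))]; likewise for [S]. *)
Lemma A_bounded_sharp : exists2 c : R, 0 <= c & forall x, p x = 1 ->
  [/\ p (T x) <= c, p (S x) <= c & p (S (T x)) <= c].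
Proof.
have [SB _] := sharpP; have [TB _] := T_BA.
have [|c c0 STc] := A_comp_bound _ _ SB TB.
  by move=> x y; rewrite sharp_adjointl sharp_adjointr.
have [|d d0 TSd] := A_comp_bound _ _ TB SB.
  by move=> x y; rewrite -sharp_adjointr sharp_adjointl.
(* [u ^ 2 <= c] implies [u <= c + 1], which spares a square root. *)
exists (c + d + 1); first by rewrite !addr_ge0.
move=> x px; have h := STc _ px; have h' := TSd _ px; split; last by lra.
- have := cauchy_schwarz ss (S (T x)) x.
  by rewrite sharp_adjointl px mulr1; nra.
- have := cauchy_schwarz ss (T (S x)) x.
  by rewrite -sharp_adjointr px mulr1; nra.
Qed.

(** * Values and bounds of the operators indexed by [theta] *)

Local Notation Bplus theta := ((cos theta)%:C *: A_Re dot A T + A_abs2 dot A T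
                        + (sin theta)%:C *: A_Im dot A T).
Local Notation Bminus theta := ((cos theta)%:C *: A_Re dot A T - A_abs2 dot A T
                        + (sin theta)%:C *: A_Im dot A T).

(** The forms of [S] and [T] at [x] are complex conjugates; the same fact gives [A_Im_num]. *)
Lemma A_Re_num x : complex.Re (s (A_Re dot A T x) x) = complex.Re (s (T x) x).
Proof.
rewrite /A_Re -[(2^-1 *: _) x]/(2^-1 *: (T x + S x)).
have -> : (2^-1 : R[i]) = (2^-1 : R)%:C by rewrite fmorphV rmorph_nat.
by rewrite (rhoZl ss) (rhoDl ss) sharp_adjointl (rhoC ss x); field.
Qed.

Lemma A_ImE x : A_Im dot A T x = (0 -i* (2^-1 : R)) *: (T x - S x).
Proof.
rewrite /A_Im -[((2 * _)^-1 *: _) x]/((2 * 'i)^-1 *: (T x - S x)); congr (_ *: _).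
rewrite invfM -[2]/(2%:R) -(rmorph_nat (real_complex R)) -fmorphV/=.
have -> : ('i)^-1 = - 'i :> R[i].
  apply: (mulfI (x := 'i)); first by rewrite eq_complex/= oner_eq0 andbF.
  rewrite divff ?mulrN -?expr2 ?sqr_i ?opprK//.
  by rewrite eq_complex/= oner_eq0 andbF.
by congr (_ +i* _); ring.
Qed.

Lemma A_Im_num x : complex.Re (s (A_Im dot A T x) x) = complex.Im (s (T x) x).
Proof.
rewrite A_ImE (semi_innerZl ss) (semi_innerDl ss) -(scaleN1r (S x)) (semi_innerZl ss).
rewrite sharp_adjointl (semi_innerC ss x).
by case: (s (T x) x) => a b /=; field.
Qed.

Lemma A_abs2_num x : complex.Re (s (A_abs2 dot A T x) x) = p (T x).
Proof. by rewrite /A_abs2/= sharp_adjointl. Qed.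

Lemma Bplus_num theta (l : R) x : p x = 1 ->
  complex.Re (s ((Bplus theta - l%:C *: idfun) x) x) =
  cos theta * complex.Re (s (T x) x) + sin theta * complex.Im (s (T x) x)
  + p (T x) - l.
Proof.
move=> px; rewrite -[(_ - _ : H -> H) x]/((cos theta)%:C *: A_Re dot A T x
  + A_abs2 dot A T x + (sin theta)%:C *: A_Im dot A T x - l%:C *: x).
rewrite !(rhoDl ss) (rhoNl ss) !(rhoZl ss) px A_Re_num A_Im_num A_abs2_num.
by ring.
Qed.

Lemma Bminus_num theta x :
  complex.Re (s (Bminus theta x) x) =
  cos theta * complex.Re (s (T x) x) + sin theta * complex.Im (s (T x) x)
  - p (T x).
Proof.
rewrite -[(_ + _ : H -> H) x]/((cos theta)%:C *: A_Re dot A T x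
  - A_abs2 dot A T x + (sin theta)%:C *: A_Im dot A T x).
rewrite !(rhoDl ss) (rhoNl ss) !(rhoZl ss) A_Re_num A_Im_num A_abs2_num.
by ring.
Qed.

(** Uniformity in [theta] is what keeps the suprema over angles finite. *)
Lemma B_bounded : exists2 K : R, 0 <= K & forall theta x, p x = 1 ->
  (forall l : R, p ((Bplus theta - l%:C *: idfun) x) <= K + 2 * l ^+ 2) /\
  p (Bminus theta x) <= K.
Proof.
have [c c0 cP] := A_bounded_sharp.
(* Each of the three summands is bounded by [c]; adding the second gives [4 c], the third [10 c],
   and subtracting [l x] gives [20 c + 2 l ^ 2]. *)
exists (20 * c); first by rewrite mulr_ge0.
move=> theta x px; have [Tc Sc Uc] := cP _ px.
have sq_le1 (t : R) y : t ^+ 2 <= 1 -> p y <= c -> p (t%:C *: y) <= c.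
  move=> t1 yc; rewrite (sqnormZ ss)/= expr0n addr0.
  by apply: le_trans yc; rewrite ler_piMl// (semi_inner_ge0 ss).
have cs := cos2Dsin2 theta.
have half (a : R[i]) y : complex.Re a ^+ 2 + complex.Im a ^+ 2 = 4^-1 ->
    p y <= 4 * c -> p (a *: y) <= c.
  by move=> ha yc; rewrite (sqnormZ ss) ha; lra.
have Rc : p (A_Re dot A T x) <= c.
  apply: (half 2^-1 (T x + S x)).
    have -> : (2^-1 : R[i]) = (2^-1 : R)%:C by rewrite fmorphV rmorph_nat.
    by rewrite /=; field.
  by apply: le_trans (sqnormD_le ss _ _) _; lra.
have Ic : p (A_Im dot A T x) <= c.
  rewrite A_ImE; apply: half; first by rewrite /=; field.
  by apply: le_trans (sqnormB_le ss _ _) _; lra.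
have cR : p ((cos theta)%:C *: A_Re dot A T x) <= c.
  by apply: sq_le1 => //; have := sqr_ge0 (sin theta); lra.
have sI : p ((sin theta)%:C *: A_Im dot A T x) <= c.
  by apply: sq_le1 => //; have := sqr_ge0 (cos theta); lra.
split=> [l|].
  apply: le_trans (sqnormB_le ss (_ + _ + _) (l%:C *: x)) _.
  rewrite [p (l%:C *: x)](sqnormZ ss) px/= expr0n addr0 mulr1.
  rewrite lerD2r; have := sqnormD_le ss ((cos theta)%:C *: A_Re dot A T x
    + A_abs2 dot A T x) ((sin theta)%:C *: A_Im dot A T x).
  have := sqnormD_le ss ((cos theta)%:C *: A_Re dot A T x) (A_abs2 dot A T x).
  by rewrite -[complex.Re (s (A_abs2 dot A T x) _)]/(p (S (T x))); lra.
have := sqnormD_le ss ((cos theta)%:C *: A_Re dot A T x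
    - A_abs2 dot A T x) ((sin theta)%:C *: A_Im dot A T x).
have := sqnormB_le ss ((cos theta)%:C *: A_Re dot A T x) (A_abs2 dot A T x).
rewrite -[complex.Re (s (A_abs2 dot A T x) _)]/(p (S (T x))).
by move=> h1 h2; apply: le_trans h2 _; lra.
Qed.

Lemma dw_pointwise (l : R) x : p x = 1 -> exists theta : R,
  complex.Re (s (T x) x) ^+ 2 + complex.Im (s (T x) x) ^+ 2 + p (T x) ^+ 2 <=
  2 * `|l| * A_opnorm dot A (Bplus theta - l%:C *: idfun)
  + 2^-1 * A_opnorm dot A (Bplus theta - (2 * l)%:C *: idfun) ^+ 2
  + 2^-1 * A_opnorm dot A (Bminus theta) ^+ 2.
Proof.
move=> px; have [K K0 KP] := B_bounded.
have [theta thetaE] := exists_angle _ (complex.Re (s (T x) x)) (complex.Im (s (T x) x)).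
exists theta; set u := Num.sqrt _ in thetaE.
have <- : u ^+ 2 = complex.Re (s (T x) x) ^+ 2 + complex.Im (s (T x) x) ^+ 2.
  by rewrite sqr_sqrtr// addr_ge0 ?sqr_ge0.
have := A_opnorm_numrange _ _ x (fun y py => (KP theta y py).2) px.
have N_le l' := A_opnorm_numrange _ _ x (fun y py => (KP theta y py).1 l') px.
have := N_le (2 * l); have := N_le l.
rewrite !(Bplus_num _ _ x px) Bminus_num thetaE.
move: (p (T x)) => r.
move: (A_opnorm dot A (Bminus theta)) (A_opnorm dot A (_ - l%:C *: _))
  (A_opnorm dot A (_ - (2 * l)%:C *: _)) => n3 n1 n2 h1 h2 h3.
have sq_le (z n : R) : `|z| <= n -> z ^+ 2 <= n ^+ 2.
  move=> zn; rewrite -real_normK ?num_real// lerXn2r// nnegrE//.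
  exact: le_trans zn.
have := sq_le _ _ h2; have := sq_le _ _ h3.
(* With [s = u + r], only the term [2 l (s - l)] depends on the sign of [l]; absolute values remove
   it. *)
have : l * (u + r - l) <= `|l| * n1.
  apply: le_trans (ler_norm _) _; rewrite normrM ler_wpM2l//.
by move: `|l| => al; lra.
Qed.

End AForm.

(** * Suprema over angles and the infimum over [lambda] *)

Theorem theorem2p19 (R : realType) (H : completeNormedModType R[i])
    (dot : {dot H for (@Num.conj R[i])}) (dot_norm : induces_norm dot)
    (A : H -> H) (A_psd : psd_operator dot A)
    (T : H -> H) (T_BA : A_adjointable dot A T) :
  dw dot A T ^+ 2 <=
    inf (range (fun lambda : R => sup (range (fun theta : R =>
      2 * `|lambda| *
        A_opnorm dot A ((cos theta)%:C *: A_Re dot A T + A_abs2 dot A T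
                        + (sin theta)%:C *: A_Im dot A T
                        - lambda%:C *: idfun)
      + 2^-1 *
        A_opnorm dot A ((cos theta)%:C *: A_Re dot A T + A_abs2 dot A T
                        + (sin theta)%:C *: A_Im dot A T
                        - (2 * lambda)%:C *: idfun) ^+ 2
      + 2^-1 *
        A_opnorm dot A ((cos theta)%:C *: A_Re dot A T - A_abs2 dot A T
                        + (sin theta)%:C *: A_Im dot A T) ^+ 2))))
  /\
  dw dot A T ^+ 2 <=
    2^-1 * sup (range (fun theta : R =>
      A_opnorm dot A ((cos theta)%:C *: A_Re dot A T + A_abs2 dot A T
                      + (sin theta)%:C *: A_Im dot A T) ^+ 2
      + A_opnorm dot A ((cos theta)%:C *: A_Re dot A T - A_abs2 dot A T
                        + (sin theta)%:C *: A_Im dot A T) ^+ 2)).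
Proof.
have [K K0 KP] := B_bounded dot_norm A_psd T_BA.
pose B theta : H -> H := (cos theta)%:C *: A_Re dot A T + A_abs2 dot A T
  + (sin theta)%:C *: A_Im dot A T.
pose C theta : H -> H := (cos theta)%:C *: A_Re dot A T - A_abs2 dot A T
  + (sin theta)%:C *: A_Im dot A T.
have B_le theta l : 0 <= A_opnorm dot A (B theta - l%:C *: idfun)
    <= Num.sqrt (K + 2 * l ^+ 2).
  apply: (A_opnorm_sqr_le dot_norm A_psd); first by rewrite addr_ge0// mulr_ge0// sqr_ge0.
  by move=> x px; exact: (KP theta x px).1.
have C_le theta : 0 <= A_opnorm dot A (C theta) <= Num.sqrt K.
  apply: (A_opnorm_sqr_le dot_norm A_psd) => // x px.
  exact: (KP theta x px).2.
pose F l theta := 2 * `|l| * A_opnorm dot A (B theta - l%:C *: idfun)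
  + 2^-1 * A_opnorm dot A (B theta - (2 * l)%:C *: idfun) ^+ 2
  + 2^-1 * A_opnorm dot A (C theta) ^+ 2.
have dw_le l : dw dot A T ^+ 2 <= sup (range (F l)).
  have F_le theta : 0 <= F l theta <= 2 * `|l| * Num.sqrt (K + 2 * l ^+ 2)
      + 2^-1 * Num.sqrt (K + 2 * (2 * l) ^+ 2) ^+ 2 + 2^-1 * Num.sqrt K ^+ 2.
    have /andP[a0 a1] := B_le theta l; have /andP[b0 b1] := B_le theta (2 * l).
    have /andP[c0 c1] := C_le theta.
    rewrite /F !addr_ge0 ?mulr_ge0 ?exprn_ge0//= !lerD ?ler_wpM2l ?mulr_ge0//.
      by rewrite lerXn2r ?nnegrE ?sqrtr_ge0.
    by rewrite lerXn2r ?nnegrE ?sqrtr_ge0.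
  have F_sup theta : F l theta <= sup (range (F l)).
    exact: le_sup_range (fun u => (elimT andP (F_le u)).2).
  apply: (dw_sqr_le dot_norm A_psd).
    (* Nonnegativity of the bound is needed separately, in case there are no unit vectors. *)
    by apply: le_trans (F_sup 0); have /andP[] := F_le 0.
  move=> x px; have [theta] := dw_pointwise dot_norm A_psd T_BA l x px.
  by move/le_trans; apply; exact: F_sup.
split.
  apply: lb_le_inf; first by exists (sup (range (F 0))), 0.
  by move=> _ [l _ <-]; exact: dw_le.
have BE theta : B theta - (0 : R)%:C *: idfun = B theta by rewrite scale0r subr0.
(* At [l = 0] the first term and both shifts disappear. *)
have := dw_le 0.
have -> : F 0 = fun theta => 2^-1 * (A_opnorm dot A (B theta) ^+ 2
    + A_opnorm dot A (C theta) ^+ 2).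
  by apply/funext => theta; rewrite /F normr0 !mulr0 mul0r add0r BE mulrDr.
(* Pulling the factor 1/2 out of the supremum requires only an inequality, checked angle by
   angle. *)
move=> /le_trans; apply; apply: ge_sup; first by eexists; exists 0.
move=> _ [theta _ <-]; rewrite ler_pM2l ?invr_gt0//.
apply: (@le_sup_range _ (fun theta => A_opnorm dot A (B theta) ^+ 2
  + A_opnorm dot A (C theta) ^+ 2)
  (Num.sqrt (K + 2 * 0 ^+ 2) ^+ 2 + Num.sqrt K ^+ 2)) => u.
have /andP[b0 b1] := B_le u 0; have /andP[c0 c1] := C_le u.
by rewrite BE in b0 b1; rewrite lerD// lerXn2r ?nnegrE ?sqrtr_ge0.
Qed.
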